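(* Let $q$ be a prime power, let $s\ge1$, $m\ge1$ and $0\le u\le m$ be integers, and let $\mathbf{e}\in\mathbb{N}^s$. Let $C_1,\dots,C_s$ be $m\times m$ matrices over $\mathbb{F}_q$ and put $C:=(C_1^\top\mid C_2^\top\mid\cdots\mid C_s^\top)\in\mathbb{F}_q^{m\times sm}$. Let $\mathcal{C}^\perp$ be the dual space of the row space $\mathcal{C}$ of $C$. Then: (a) If $C_1,\dots,C_s$ are all nonsingular, then they generate a digital $(u,m,\mathbf{e},s)$-net over $\mathbb{F}_q$ if and only if $\delta_{m,\mathbf{e}}(\mathcal{C}^\perp)\ge m-u+1$. (b) For arbitrary $C_1,\dots,C_s$: if $\delta_{m,\mathbf{e}}(\mathcal{C}^\perp)\ge m-u+1$, then $C_1,\dots,C_s$ generate a digital $(u,m,\mathbf{e},s)$-net over $\mathbb{F}_q$; and if $C_1,\dots,C_s$ generate a digital $(u,m,\mathbf{e},s)$-net over $\mathbb{F}_q$, then $\delta_{m,\mathbf{e}}(\mathcal{C}^\perp)\ge m-u$.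
   Context: $\mathbb{N}$ denotes the positive integers. The dual space of a subspace $\mathcal{C}\subseteq\mathbb{F}_q^{sm}$ is $\{\mathbf{A}\in\mathbb{F}_q^{sm}:\mathbf{A}\cdot\mathbf{B}=0\ \forall \mathbf{B}\in\mathcal{C}\}$ with the standard dot product. For $\mathbf{a}=(a_1,\dots,a_m)\in\mathbb{F}_q^m$ and $e\in\mathbb{N}$, $v_e(\mathbf{a})=0$ if $\mathbf{a}=\mathbf{0}$ and $v_e(\mathbf{a})=\min\{m,e\lceil \max\{j:a_j\ne0\}/e\rceil\}$ otherwise. For $\mathbf{A}=(\mathbf{a}^{(1)},\dots,\mathbf{a}^{(s)})\in\mathbb{F}_q^{sm}$ with $\mathbf{a}^{(i)}\in\mathbb{F}_q^m$ and $\mathbf{e}=(e_1,\dots,e_s)$, $V_{m,\mathbf{e}}(\mathbf{A})=\sum_{i=1}^s v_{e_i}(\mathbf{a}^{(i)})$. For a linear subspace $\mathcal{N}\subseteq\mathbb{F}_q^{sm}$, $\delta_{m,\mathbf{e}}(\mathcal{N})=\min_{\mathbf{A}\in\mathcal{N}\setminus\{\mathbf{0}\}}V_{m,\mathbf{e}}(\mathbf{A})$ if $\mathcal{N}\ne\{\mathbf{0}\}$ and $sm+1$ otherwise. An elementary interval in base $b$ is $J=\prod_{i=1}^s[a_ib^{-d_i},(a_i+1)b^{-d_i})$ with integers $d_i\ge0$, $0\le a_i<b^{d_i}$. A set of $b^m$ points in $[0,1)^s$ is a $(u,m,\mathbf{e},s)$-net in base $b$ if every elementary interval $J$ in base $b$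 with $\lambda_s(J)\ge b^{u-m}$ and $e_i\mid d_i$ for all $i$ contains exactly $b^m\lambda_s(J)$ points. Digital net over $\mathbb{F}_q$ with generating matrices $C_1,\dots,C_s$: with $Z_q=\{0,\dots,q-1\}$ and bijections $\eta_r:Z_q\to\mathbb{F}_q$, $\kappa_{i,j}:\mathbb{F}_q\to Z_q$, for $0\le n<q^m$ with base-$q$ digits $n_0,\dots,n_{m-1}$ set $(y^{(i)}_{n,1},\dots,y^{(i)}_{n,m})^\top=C_i(\eta_0(n_0),\dots,\eta_{m-1}(n_{m-1}))^\top$ and $x_n^{(i)}=\sum_{j=1}^m\kappa_{i,j}(y^{(i)}_{n,j})q^{-j}$; the points $\mathbf{x}_n=(x_n^{(1)},\dots,x_n^{(s)})$, $0\le n<q^m$, form the digital net. The matrices generate a digital $(u,m,\mathbf{e},s)$-net over $\mathbb{F}_q$ if this point set is a $(u,m,\mathbf{e},s)$-net in base $q$. *)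

(* Defs.v *)
From HB Require Import structures.
From mathcomp Require Import all_boot all_order all_algebra all_field.
From mathcomp Require Import all_classical all_reals all_analysis.

Set Implicit Arguments.
Unset Strict Implicit.
Unset Printing Implicit Defensive.

Import Order.TTheory GRing.Theory Num.Theory.
Local Open Scope ring_scope.

Section LinearCodes.
Variable F : finFieldType.

Definition dotv n (A B : 'rV[F]_n) : F := \sum_(j < n) A 0 j * B 0 j.

Definition row_space k n (M : 'M[F]_(k, n)) : {set 'rV[F]_n} :=
  [set A | (A <= M)%MS].

Definition dual_space n (N : {set 'rV[F]_n}) : {set 'rV[F]_n} :=
  [set A | [forall B in N, dotv A B == 0]].

(* max {j : a_j != 0} with coordinates numbered from 1 *)
Definition last_nz m (a : 'rV[F]_m) : nat :=
  \max_(j < m | a 0 j != 0) (val j).+1.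

(* For e > 0, (x + e.-1) %/ e is the ceiling of x / e. *)
Definition v_weight m (e : nat) (a : 'rV[F]_m) : nat :=
  if a == 0 then 0%N
  else minn m (e * ((last_nz a + e.-1) %/ e)).

(* F^(sm) is 'rV[F]_(\sum_(i < s) m), split into s blocks of length m. *)
Definition V_weight s m (e : 'I_s -> nat) (A : 'rV[F]_(\sum_(i < s) m)) : nat :=
  \sum_(i < s) v_weight (e i) (submxrow A i).

(* The minimum of V_weight over the nonzero elements of N, and s * m + 1 if
   there are none. *)
Definition delta s m (e : 'I_s -> nat)
    (N : {set 'rV[F]_(\sum_(i < s) m)}) : nat :=
  if [pick A in N :\ 0] is Some A0
  then V_weight e [arg min_(A < A0 in N :\ 0) V_weight e A]
  else (s * m).+1.

Definition joint_mx s m (C : 'I_s -> 'M[F]_m) : 'M[F]_(m, \sum_(i < s) m) :=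
  \mxrow_(i < s) (C i)^T.

End LinearCodes.

Section Nets.
Variable R : realType.

Definition elem_side (b d a : nat) : interval R :=
  `[a%:R / b%:R ^+ d, a.+1%:R / b%:R ^+ d[.

Definition in_elem_interval s (b : nat) (d a : 'I_s -> nat) (x : 'rV[R]_s) :=
  [forall i, x 0 i \in elem_side b (d i) (a i)].

(* The s-dimensional Lebesgue measure of a box is the product of the
   one-dimensional Lebesgue measures of its sides. *)
Definition elem_volume s (b : nat) (d a : 'I_s -> nat) : \bar R :=
  (\prod_(i < s) lebesgue_measure [set` elem_side b (d i) (a i)]%classic)%E.

(* The b ^ m points are an indexed family: repeated points are counted with
   their multiplicity. *)
Definition is_net s (u m : nat) (e : 'I_s -> nat) (b : nat)
    (x : 'I_(b ^ m) -> 'rV[R]_s) : Prop :=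
  (forall n i, 0 <= x n 0 i < 1) /\
  (forall d a : 'I_s -> nat,
     (forall i, (a i < b ^ d i)%N) ->
     (forall i, (e i %| d i)%N) ->
     ((b%:R ^ (u%:Z - m%:Z))%:E <= elem_volume b d a)%E ->
     (#|[set n | in_elem_interval b d a (x n)]|%:R%:E
        = (b ^ m)%:R%:E * elem_volume b d a)%E).

End Nets.

Section DigitalNets.
Variables (R : realType) (F : finFieldType).

Lemma card_field_gt0 : (0 < #|F|)%N.
Proof. exact: ltnW (finNzRing_gt1 F). Qed.

(* the coefficient of q ^ r in the base q expansion of n, for q = #|F| *)
Definition digit (n r : nat) : 'I_#|F| :=
  Ordinal (ltn_pmod (n %/ #|F| ^ r) card_field_gt0).

Variables (s m : nat).
Variables (eta : 'I_m -> 'I_#|F| -> F) (kappa : 'I_s -> 'I_m -> F -> 'I_#|F|).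
Variable C : 'I_s -> 'M[F]_m.

Definition digit_vec (n : nat) : 'cV[F]_m := \col_(r < m) eta r (digit n r).

(* Column j : 'I_m carries the digit y_(n, j+1), of weight q ^ -(j+1). *)
Definition digital_net (n : 'I_(#|F| ^ m)) : 'rV[R]_s :=
  \row_(i < s) \sum_(j < m)
     (kappa i j ((C i *m digit_vec n) j 0))%:R / #|F|%:R ^+ (val j).+1.

Definition generates_digital_net (u : nat) (e : 'I_s -> nat) : Prop :=
  is_net u e digital_net.

End DigitalNets.

(* Main.v *)
Require Import Defs.
From HB Require Import structures.
From mathcomp Require Import all_boot all_order all_algebra all_field.
From mathcomp Require Import all_classical all_reals all_analysis.
From mathcomp Require Import mxabelem zify.

Set Implicit Arguments.
Unset Strict Implicit.
Unset Printing Implicit Defensive.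

(* A point of the digital net lies in an elementary interval of depths d_i exactly when the
   first d_i rows of C_i, applied to its digit vector, take prescribed values. As the digit
   vectors run once through F^m, every such interval contains the right number of points iff
   the linear map given by these rows is onto, that is, iff no nonzero vector of the dual
   space is supported on the first d_i coordinates of each block. Vectors A of the dual space
   supported there have V(A) <= \sum_i d_i, and conversely d_i := v_(e_i)(a_i) is an
   admissible choice unless the cap m is attained in some block with e_i not dividing m. In
   that case V(A) >= m, which leaves only V(A) = m - u with u = 0 and a single nonzero block
   a_i, where a_i C_i = 0; this is impossible for C_i nonsingular. *)

Import Order.TTheory GRing.Theory Num.Theory.
Local Open Scope ring_scope.

(** * Fibres of linear maps over a finite field *)

(** The fibre is a coset of the left kernel of [B], of dimension [k - \rank B]. *)
Lemma card_mulmx_fiber (F : finFieldType) k n (B : 'M[F]_(k, n)) (y0 : 'rV_k) :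
  #|[set y : 'rV_k | y *m B == y0 *m B]| = (#|F| ^ (k - \rank B))%N.
Proof.
rewrite -mxrank_ker -card_rowg -(card_imset (mem (rowg _)) (addrI y0)).
apply: eq_card => y; rewrite inE; apply/eqP/imsetP => [yB|[z zK ->]].
  exists (y - y0); last by rewrite addrC subrK.
  by rewrite mem_rowg; apply/sub_kermxP; rewrite mulmxBl yB subrr.
by move: zK; rewrite mem_rowg => /sub_kermxP zB; rewrite mulmxDl zB addr0.
Qed.

(** [P] is an orthogonal projection. Both sides say that [M *m P] and [P] have the same row space:
    the first by counting fibres, the second by duality. *)
Lemma mulmx_equidistributedP (F : finFieldType) k n (M : 'M[F]_(k, n)) (P : 'M[F]_n) :
    P^T = P -> P *m P = P ->
  (forall w : 'rV_n, #|[set y : 'rV_k | y *m M *m P == w *m P]| =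
     (#|F| ^ (k - \rank P))%N) <->
  (forall A : 'rV_n, A *m P = A -> A *m M^T = 0 -> A = 0).
Proof.
move=> Psym Pid; split=> [fib A AP AM|inj w].
  have AMP (y : 'rV_k) : y *m M *m P *m A^T = 0.
    rewrite -mulmxA -{1}Psym -trmx_mul AP -mulmxA -[M]trmxK -trmx_mul AM.
    by rewrite trmx0 mulmx0.
  have PA : P *m A^T = 0.
    apply/row_matrixP => i; rewrite row_mul row0.
    (* Only nonemptiness of the fibre matters: it puts row [i] of [P] in the row space of [M *m P],
       which is orthogonal to [A]. *)
    have /card_gt0P[y] : (0 < #|[set y : 'rV_k | y *m M *m P == row i P *m P]|)%N.
      by rewrite fib expn_gt0 card_field_gt0.
    rewrite inE. by rewrite -(row_mul i P P) Pid => /eqP <-; exact: AMP.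
  by rewrite -AP -[P]Psym -[A]trmxK -trmx_mul PA trmx0.
(* After transposing, this says that [M^T] is injective on the row space of [P]. *)
have rk : \rank (M *m P) = \rank P.
  rewrite -mxrank_tr trmx_mul Psym; apply/mxrank_injP.
  apply/eqP/row_matrixP => i; rewrite row0; set v := row i _.
  have : (v <= P :&: kermx M^T)%MS by rewrite row_sub.
  rewrite sub_capmx => /andP[/submxP[z vz] /sub_kermxP vM].
  by apply: inj; rewrite // vz -mulmxA Pid.
have sub : (P <= M *m P)%MS by rewrite -(geq_leqif (mxrank_leqif_sup (submxMl M P))) rk.
have /submxP[y0 ->] : (w *m P <= M *m P)%MS by apply: submx_trans (submxMl _ _) sub.
rewrite -rk -(card_mulmx_fiber (M *m P) y0); apply: eq_card => y.
by rewrite !inE !mulmxA.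
Qed.

(** * The weight of a single block, and dual membership *)

Section Weight.
Variable F : finFieldType.

Lemma mul_pid_mxP m d (a : 'rV[F]_m) (j : 'I_m) :
  (a *m pid_mx d) 0 j = if (j < d)%N then a 0 j else 0.
Proof.
rewrite mxE (bigD1 j) //= mxE eqxx /= big1 => [|i ij].
  by case: ifP; rewrite ?mulr1 ?mulr0 addr0.
by rewrite mxE (inj_eq val_inj) (negPf ij) mulr0.
Qed.

Lemma mul_pid_mx_last_nz m d (a : 'rV[F]_m) :
  (a *m pid_mx d == a) = (last_nz a <= d)%N.
Proof.
apply/eqP/bigmax_leqP => [E j|le_d].
  by rewrite -E mul_pid_mxP; case: ifP => //; rewrite eqxx.
apply/rowP => j; rewrite mul_pid_mxP; case: ifPn => // jd.
by apply/esym/eqP; apply: contraNT jd => /le_d.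
Qed.

Lemma last_nz_le m (a : 'rV[F]_m) : (last_nz a <= m)%N.
Proof. by apply/bigmax_leqP => j _; exact: ltn_ord. Qed.

(** Rounding up to a multiple of [e] cannot pass [d], itself a multiple of [e], and the cap [m] is
    harmless because [last_nz a <= m]. *)
Lemma v_weight_le m e d (a : 'rV[F]_m) : (0 < e)%N -> (e %| d)%N -> (d <= m)%N ->
  (v_weight e a <= d)%N = (last_nz a <= d)%N.
Proof.
move=> e0 /dvdnP[c ->] dm; rewrite /v_weight; case: eqP => [->|_].
  by rewrite leq0n; apply/esym/bigmax_leqP => j; rewrite mxE eqxx.
have last_m : (last_nz a <= m)%N by exact: last_nz_le.
rewrite geq_min [(e * _)%N]mulnC leq_pmul2r //.
have := divn_eq (last_nz a + e.-1) e; have := ltn_pmod (last_nz a + e.-1) e0.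
case: (leqP m (c * e)) => /= [mc _ _|_ r_lt kr]; first by rewrite (leq_trans last_m).
by apply/idP/idP; nia.
Qed.

Lemma last_nz_le_v_weight m e (a : 'rV[F]_m) : (0 < e)%N ->
  (last_nz a <= v_weight e a)%N.
Proof.
move=> e0; rewrite /v_weight; case: eqP => [->|_].
  by apply/bigmax_leqP => j; rewrite mxE eqxx.
rewrite leq_min last_nz_le /=.
have := divn_eq (last_nz a + e.-1) e; have := ltn_pmod (last_nz a + e.-1) e0.
nia.
Qed.

Lemma v_weight_eq0 m e (a : 'rV[F]_m) : (0 < e)%N ->
  (v_weight e a == 0)%N = (a == 0).
Proof.
move=> e0; apply/eqP/eqP => [v0|->]; last by rewrite /v_weight eqxx.
have := last_nz_le_v_weight a e0; rewrite v0 -mul_pid_mx_last_nz => /eqP <-.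
by rewrite pid_mx_0 mulmx0.
Qed.

Lemma dvdn_v_weight m e (a : 'rV[F]_m) : v_weight e a != m -> (e %| v_weight e a)%N.
Proof.
rewrite /v_weight; case: (a =P 0) => // _; rewrite /minn; case: ltnP => _; first by rewrite eqxx.
by rewrite dvdn_mulr.
Qed.

Lemma mem_dual_row_space k n (M : 'M[F]_(k, n)) (A : 'rV_n) :
  (A \in dual_space (row_space M)) = (A *m M^T == 0).
Proof.
have dotvE (B : 'rV_n) : dotv A B = (A *m B^T) 0 0.
  by rewrite mxE; apply: eq_bigr => j _; rewrite mxE.
rewrite inE; apply/forall_inP/eqP => [dual|AM B].
  apply/rowP => i.
  have /dual/eqP : row i M \in row_space M by rewrite inE row_sub.
  by rewrite dotvE => dot0; rewrite [RHS]mxE -dot0 !mxE; apply: eq_bigr => j _; rewrite !mxE.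
by rewrite inE => /submxP[z ->]; rewrite dotvE trmx_mul mulmxA AM mul0mx mxE.
Qed.

End Weight.

(** * Dual distance versus independence of leading rows *)

Section Duality.
Variables (F : finFieldType) (s m : nat).
Implicit Types (A : 'rV[F]_(\sum_(i < s) m)) (d e : 'I_s -> nat).

(** Orthogonal projection onto the first [d i] coordinates of each block; it serves as [P] in
    [mulmx_equidistributedP]. *)
Definition block_mask d : 'M[F]_(\sum_(i < s) m) := \mxdiag_(i < s) pid_mx (d i).

Lemma tr_block_mask d : (block_mask d)^T = block_mask d.
Proof. by rewrite tr_mxdiag; apply: eq_mxdiag => i; rewrite tr_pid_mx. Qed.

Lemma rank_block_mask d : (forall i, (d i <= m)%N) ->
  \rank (block_mask d) = (\sum_i d i)%N.
Proof.
by move=> dm; rewrite rank_mxdiag; apply: eq_bigr => i _; rewrite rank_pid_mx.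
Qed.

Lemma submxrow_mul_block_mask k d (A : 'M[F]_(k, \sum_(i < s) m)) i :
  submxrow (A *m block_mask d) i = submxrow A i *m pid_mx (d i).
Proof. by rewrite -{1}[A]submxrowK mul_mxrow_mxdiag mxrowK. Qed.

Lemma block_mask_idem d : (forall i, (d i <= m)%N) ->
  block_mask d *m block_mask d = block_mask d.
Proof.
move=> dm; apply/mxrowP => i; rewrite submxrow_mul_block_mask.
by rewrite -[block_mask d]mul1mx !submxrow_mul_block_mask -mulmxA pid_mx_id.
Qed.

Lemma mul_block_maskP d A :
  A *m block_mask d = A <-> forall i, (last_nz (submxrow A i) <= d i)%N.
Proof.
rewrite -mxrowP; split=> H i; have := H i.
  by rewrite -mul_pid_mx_last_nz submxrow_mul_block_mask => ->.
by rewrite -mul_pid_mx_last_nz submxrow_mul_block_mask => /eqP.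
Qed.

(** The bound on [t] makes the default value of [delta] satisfy the left side when [N] has no
    nonzero element. *)
Lemma leq_delta e (N : {set 'rV[F]_(\sum_(i < s) m)}) t : (t <= (s * m).+1)%N ->
  (t <= delta e N)%N <-> (forall A, A \in N -> A != 0 -> (t <= V_weight e A)%N).
Proof.
move=> t_le; rewrite /delta; case: pickP => [A0 A0N|N0].
  case: arg_minnP => // A AN Amin; split=> [tA B BN B0|]; last first.
    by move: AN; rewrite !inE => /andP[A0' AN] ->.
  by apply: leq_trans tA (Amin B _); rewrite !inE B0.
split=> // _ A AN A0; have := N0 A; by rewrite !inE A0 AN.
Qed.

Variable C : 'I_s -> 'M[F]_m.

Lemma mul_joint_mx_tr A : A *m (joint_mx C)^T = \sum_i submxrow A i *m C i.
Proof.
rewrite -{1}[A]submxrowK tr_mxrow mul_mxrow_mxcol.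
by apply: eq_bigr => i _; rewrite trmxK.
Qed.

(* A *m (joint_mx C)^T = \sum_i a_i *m C i is a linear combination of the rows of the
   matrices C i, and A *m block_mask d = A restricts it to the first d i rows of C i: the
   condition says that these rows are linearly independent for all admissible d. *)
Definition admissible_rows_free (u : nat) e := forall d,
  (forall i, e i %| d i)%N -> (\sum_i d i <= m - u)%N ->
  forall A, A *m block_mask d = A -> A *m (joint_mx C)^T = 0 -> A = 0.

Variables (e : 'I_s -> nat) (u : nat).
Hypotheses (s_gt0 : (0 < s)%N) (m_gt0 : (0 < m)%N) (e_gt0 : forall i, (0 < e i)%N).

Let delta_dual := delta e (dual_space (row_space (joint_mx C))).

Lemma leq_delta_dual t : (t <= m.+1)%N ->
  (t <= delta_dual)%N <->
  (forall A, A *m (joint_mx C)^T = 0 -> A != 0 -> (t <= V_weight e A)%N).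
Proof.
(* As [s >= 1], [t <= m + 1] implies [t <= s * m + 1]. *)
move=> tm; rewrite leq_delta; last by nia.
split=> le_V A; first by move/eqP; rewrite -mem_dual_row_space; exact: le_V.
by rewrite mem_dual_row_space => /eqP; exact: le_V.
Qed.

Lemma delta_admissible_rows_free :
  (m - u + 1 <= delta_dual)%N -> admissible_rows_free u e.
Proof.
rewrite leq_delta_dual; last by lia.
move=> le_V d ed sd A /mul_block_maskP Ad dualA; apply/eqP; apply: contraT => A0.
have d_le i : (d i <= m)%N by move: sd; rewrite (bigD1 i) //=; lia.
have : (V_weight e A <= \sum_i d i)%N by apply: leq_sum => i _; rewrite v_weight_le.
have := le_V A dualA A0; lia.
Qed.

(* A nonzero dual vector of weight at most m - u can only survive when the cap m in
   v_weight is active in one of its blocks. *)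
Lemma dual_weight_capped A : admissible_rows_free u e ->
  A *m (joint_mx C)^T = 0 -> A != 0 -> (V_weight e A <= m - u)%N ->
  exists i, v_weight (e i) (submxrow A i) = m.
Proof.
move=> free dualA A0 VA.
have [/forallP edvd|/forallPn[i ei]] :=
    boolP [forall i, e i %| v_weight (e i) (submxrow A i)]%N.
  case/eqP: A0; apply: (free _ edvd VA) => //; apply/mul_block_maskP => i.
  exact: last_nz_le_v_weight.
exists i; apply/eqP; apply: contraNT ei; exact: dvdn_v_weight.
Qed.

(** A capped block alone contributes [m], so no nonzero dual vector has weight below [m - u]. *)
Lemma admissible_rows_free_delta :
  admissible_rows_free u e -> (m - u <= delta_dual)%N.
Proof.
move=> free; apply/leq_delta_dual; first by lia.
move=> A dualA A0; rewrite leqNgt; apply/negP => VA.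
have [i vi] := dual_weight_capped free dualA A0 (ltnW VA).
by move: VA; rewrite /V_weight (bigD1 i) //= vi; lia.
Qed.

Lemma admissible_rows_free_unit_delta : (forall i, C i \in unitmx) ->
  admissible_rows_free u e -> (m - u + 1 <= delta_dual)%N.
Proof.
move=> Cu free; apply/leq_delta_dual; first by lia.
move=> A dualA A0; rewrite addn1 ltnNge; apply/negP => VA.
have [i vi] := dual_weight_capped free dualA A0 VA.
(* The capped block exhausts the whole budget [m - u <= m], so all other blocks vanish. *)
have V0 : (\sum_(j < s | j != i) v_weight (e j) (submxrow A j) = 0)%N.
  move: VA; rewrite /V_weight (bigD1 i) //= vi => VA.
  by apply/eqP; rewrite -leqn0 -(leq_add2l m) addn0 (leq_trans VA) ?leq_subr.
have A0j j : j != i -> submxrow A j = 0.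
  move=> ji; apply/eqP; rewrite -(v_weight_eq0 _ (e_gt0 j)).
  by move/eqP: V0; rewrite sum_nat_eq0 => /forall_inP/(_ j ji).
move: dualA; rewrite mul_joint_mx_tr (bigD1 i) //= big1 ?addr0 => [AiC|j /A0j ->]; last first.
  by rewrite mul0mx.
(* Cancelling [C i] makes block [i] zero, against its weight [m > 0]. *)
have /eqP := congr1 (mulmx^~ (invmx (C i))) AiC.
rewrite mulmxK // mul0mx -(v_weight_eq0 _ (e_gt0 i)) vi.
by rewrite eqn0Ngt m_gt0.
Qed.

End Duality.

(* Digits are numbered from the most significant one: for n digits the value is the
   numerator of \sum_(j < n) k j / b ^ (j + 1) over b ^ n. *)
Fixpoint radix_prefix (b : nat) (k : nat -> nat) (n : nat) : nat :=
  if n is n'.+1 then (radix_prefix b k n' * b + k n')%N else 0%N.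

(** * Base [b] expansions *)

Section Radix.
Variable b : nat.
Hypothesis b_gt0 : (0 < b)%N.

Lemma radix_prefix_lt k n : (forall j, k j < b)%N -> (radix_prefix b k n < b ^ n)%N.
Proof.
by move=> kb; elim: n => //= n IHn; have := kb n; rewrite expnSr; nia.
Qed.

Lemma radix_prefix_divn k n d : (forall j, k j < b)%N -> (d <= n)%N ->
  (radix_prefix b k n %/ b ^ (n - d))%N = radix_prefix b k d.
Proof.
move=> kb; elim: n => [|n IHn]; first by rewrite leqn0 => /eqP ->; rewrite divn1.
rewrite leq_eqVlt => /predU1P[->|]; first by rewrite subnn divn1.
rewrite ltnS => dn; rewrite subSn // expnS divnMA /= divnMDl //.
by rewrite (divn_small (kb n)) addn0 IHn.
Qed.

Lemma radix_prefix_inj k l n : (forall j, k j < b)%N -> (forall j, l j < b)%N ->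
  radix_prefix b k n = radix_prefix b l n -> forall j, (j < n)%N -> k j = l j.
Proof.
move=> kb lb; elim: n => //= n IHn E j; rewrite ltnS leq_eqVlt.
have := congr1 (divn^~ b) E; have := congr1 (modn^~ b) E.
rewrite !modnMDl !modn_small // !divnMDl // !divn_small // !addn0 => kl /IHn {}IHn.
by case/predU1P => [->|/IHn].
Qed.

Lemma eq_radix_prefix k l n : (forall j, (j < n)%N -> k j = l j) ->
  radix_prefix b k n = radix_prefix b l n.
Proof.
elim: n => //= n IHn kl; rewrite kl // IHn // => j jn; exact/kl/ltnW.
Qed.

Lemma radix_prefix_surj a n : (a < b ^ n)%N ->
  exists2 k, (forall j, k j < b)%N & radix_prefix b k n = a.
Proof.
elim: n a => [|n IHn] a; first by case: a => // _; exists (fun=> 0%N).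
rewrite expnSr => a_lt.
have [|k kb ka] := IHn (a %/ b)%N; first by rewrite ltn_divLR.
(* The digits of [a %/ b] come first, then [a %% b]; past position [n] any value below [b] would
   do. *)
exists (fun j => if (j < n)%N then k j else (a %% b)%N) => [j|/=].
  by case: ifP => // _; rewrite ltn_pmod.
rewrite ltnn [RHS](divn_eq a b) -ka; congr (_ * _ + _)%N.
by apply: eq_radix_prefix => j ->.
Qed.

Lemma eq_low_digits k n n' : (n < b ^ k)%N -> (n' < b ^ k)%N ->
  (forall r, (r < k)%N -> (n %/ b ^ r) %% b = (n' %/ b ^ r) %% b)%N -> n = n'.
Proof.
elim: k n n' => [|k IHk] n n'; first by case: n n' => [|?] [|?].
rewrite !expnSr => n_lt n'_lt E.
rewrite (divn_eq n b) (divn_eq n' b); congr (_ * _ + _)%N; last first.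
  by have := E 0%N isT; rewrite !divn1.
apply: IHk; rewrite ?ltn_divLR // => r rk.
by have := E r.+1 rk; rewrite expnS !divnMA.
Qed.

Variable R : realType.

Lemma sum_radix (k : nat -> nat) n :
  \sum_(j < n) (k j)%:R / b%:R ^+ j.+1 = (radix_prefix b k n)%:R / b%:R ^+ n :> R.
Proof.
have b0 : b%:R != 0 :> R by rewrite pnatr_eq0 -lt0n.
elim: n => [|n IHn]; first by rewrite big_ord0 mul0r.
rewrite big_ord_recr /= IHn natrD natrM mulrDl exprSr; congr (_ + _).
by rewrite -mulf_div divff ?mulr1.
Qed.

Lemma mem_elem_side (k : nat -> nat) n d a : (forall j, k j < b)%N -> (d <= n)%N ->
  (\sum_(j < n) (k j)%:R / b%:R ^+ j.+1 \in elem_side R b d a) =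
  (radix_prefix b k d == a).
Proof.
move=> kb dn; rewrite sum_radix -(radix_prefix_divn kb dn).
set N := radix_prefix b k n.
have pos r : 0 < b%:R ^+ r :> R by rewrite exprn_gt0 ?ltr0n.
have Dpos : (0 < b ^ (n - d))%N by rewrite expn_gt0 b_gt0.
(* Splitting [b ^ n] cancels [b ^ d], leaving [a * b ^ (n - d) <= N < a.+1 * b ^ (n - d)], that is,
   [N %/ b ^ (n - d) = a]. *)
rewrite /elem_side in_itv /= -{1 2}(subnK dn) exprD invfM mulrA.
rewrite ler_pM2r ?invr_gt0 // ltr_pM2r ?invr_gt0 // ler_pdivlMr // ltr_pdivrMr //.
rewrite -natrX -!natrM ler_nat ltr_nat -leq_divRL // -ltn_divLR // ltnS.
by rewrite eq_sym eqn_leq.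
Qed.
End Radix.

(** * Volumes of elementary intervals *)

Section ElementaryIntervals.
Variables (R : realType) (s b : nat).
Hypothesis b_gt1 : (1 < b)%N.
Implicit Types d a : 'I_s -> nat.

Lemma elem_volumeE d a :
  elem_volume R b d a = ((b%:R ^+ (\sum_i d i)%N)^-1)%:E.
Proof.
rewrite /elem_volume.
under [LHS]eq_bigr => i _.
  rewrite lebesgue_measure_itv /= lte_fin ltr_pM2r ?invr_gt0 ?exprn_gt0 ?ltr0n ?(ltnW b_gt1) //.
  rewrite ltr_nat ltnSn -EFinB -mulrBl -natrB // subSnn mul1r; over.
by rewrite prodEFin -prodrXr -prodfV.
Qed.

Lemma le_elem_volume u m d a : (u <= m)%N ->
  ((b%:R ^ (u%:Z - m%:Z))%:E <= elem_volume R b d a)%E = (\sum_i d i <= m - u)%N.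
Proof.
move=> um; rewrite elem_volumeE lee_fin -opprB subzn // -exprnN.
by rewrite lef_pV2 ?posrE ?exprn_gt0 ?ltr0n ?(ltnW b_gt1) // ler_eXn2l // ltr1n.
Qed.

Lemma count_elem_volume c m d a : (\sum_i d i <= m)%N ->
  (c%:R%:E = (b ^ m)%:R%:E * elem_volume R b d a)%E <-> c = (b ^ (m - \sum_i d i))%N.
Proof.
move=> dm; have b0 : b%:R != 0 :> R by rewrite pnatr_eq0 -lt0n ltnW.
rewrite elem_volumeE -EFinM natrX -expfB_cond ?(negPf b0) //.
rewrite -natrX; split=> [[/eqP]|-> //]; by rewrite eqr_nat => /eqP.
Qed.

End ElementaryIntervals.

(** * Net points in elementary intervals as solutions of linear systems *)

Section DigitalNetPoints.
Variables (R : realType) (F : finFieldType) (s m : nat).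
Variables (eta : 'I_m -> 'I_#|F| -> F) (kappa : 'I_s -> 'I_m -> F -> 'I_#|F|).
Hypotheses (eta_bij : forall r, bijective (eta r)).
Hypotheses (kappa_bij : forall i j, bijective (kappa i j)).
Variable C : 'I_s -> 'M[F]_m.

Let q_gt1 : (1 < #|F|)%N := finNzRing_gt1 F.
Let q_gt0 : (0 < #|F|)%N := ltnW q_gt1.

Lemma digit_vec_bij : bijective (fun n : 'I_(#|F| ^ m) => (digit_vec eta n)^T).
Proof.
apply: inj_card_bij => [n n' /trmx_inj En|]; last first.
  by rewrite card_mx card_ord mul1n.
apply/ord_inj/(eq_low_digits q_gt0 (ltn_ord n) (ltn_ord n')) => r rm.
have /colP/(_ (Ordinal rm)) := En; rewrite !mxE => /(bij_inj (eta_bij _)) dn.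
by move: (congr1 val dn).
Qed.

(** Indexed by [nat], with 0 from position [m] on, to fit [radix_prefix]. *)
Definition coord_digits i (v : 'rV[F]_m) (j : nat) : nat :=
  if insub j is Some j' then kappa i j' (v 0 j') : nat else 0%N.

Lemma coord_digits_ord i v (j : 'I_m) : coord_digits i v j = kappa i j (v 0 j).
Proof. by rewrite /coord_digits valK. Qed.

Lemma coord_digits_lt i v j : (coord_digits i v j < #|F|)%N.
Proof. by rewrite /coord_digits; case: insubP. Qed.

Lemma eq_coord_prefix i d (v w : 'rV[F]_m) : (d <= m)%N ->
  (radix_prefix #|F| (coord_digits i v) d == radix_prefix #|F| (coord_digits i w) d)
  = (v *m (pid_mx d : 'M[F]_m) == w *m pid_mx d).
Proof.
move=> dm; apply/eqP/eqP => [E|E].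
  apply/rowP => j; rewrite !mul_pid_mxP; case: ifP => // jd.
  have := radix_prefix_inj q_gt0 (coord_digits_lt i v) (coord_digits_lt i w) E jd.
  by rewrite !coord_digits_ord => /val_inj/(bij_inj (kappa_bij i j)).
apply: eq_radix_prefix => j jd; have jm := leq_trans jd dm.
have /rowP/(_ (Ordinal jm)) := E; rewrite !mul_pid_mxP /= jd => vw.
by rewrite (coord_digits_ord i v (Ordinal jm)) vw -(coord_digits_ord i w).
Qed.

Lemma coord_prefix_surj i d a : (d <= m)%N -> (a < #|F| ^ d)%N ->
  exists v, radix_prefix #|F| (coord_digits i v) d = a.
Proof.
move=> dm /(radix_prefix_surj q_gt0)[k kq <-].
have [j|v vk] := fin_all_exists (P := fun (j : 'I_m) x => kappa i j x = Ordinal (kq j)).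
  by have [g _ gK] := kappa_bij i j; exists (g (Ordinal (kq j))).
exists (\row_j v j); apply: eq_radix_prefix => j jd.
by rewrite (coord_digits_ord _ _ (Ordinal (leq_trans jd dm))) mxE vk.
Qed.

Let net := digital_net R eta kappa C.

Lemma digital_netE n i : net n 0 i =
  \sum_(j < m) (coord_digits i (submxrow ((digit_vec eta n)^T *m joint_mx C) i) j)%:R
     / #|F|%:R ^+ j.+1.
Proof.
rewrite mxE; apply: eq_bigr => j _; rewrite coord_digits_ord.
by rewrite mul_mxrow mxrowK -trmx_mul [(_^T) 0 j]mxE.
Qed.

Lemma digital_net_range n i : 0 <= net n 0 i < 1.
Proof.
rewrite digital_netE sum_radix // divr_ge0 ?exprn_ge0 //=.
rewrite ltr_pdivrMr ?exprn_gt0 ?ltr0n // mul1r -natrX ltr_nat.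
by apply: radix_prefix_lt => // j; exact: coord_digits_lt.
Qed.

(** Naming intervals by vectors [w] makes membership linear; by [cell_surj] no interval of depths at
    most [m] is lost. *)
Definition cell (d : 'I_s -> nat) (w : 'rV[F]_(\sum_(i < s) m)) (i : 'I_s) : nat :=
  radix_prefix #|F| (coord_digits i (submxrow w i)) (d i).

Lemma cell_lt d w i : (cell d w i < #|F| ^ d i)%N.
Proof. by apply: radix_prefix_lt => // j; exact: coord_digits_lt. Qed.

Lemma cell_surj d a : (forall i, d i <= m)%N -> (forall i, a i < #|F| ^ d i)%N ->
  exists w, forall i, cell d w i = a i.
Proof.
move=> dm aq; have [i|v va] := fin_all_exists (P := fun (i : 'I_s) v =>
  radix_prefix #|F| (coord_digits i v) (d i) = a i).
  exact: coord_prefix_surj.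
by exists (\mxrow_i v i) => i; rewrite /cell mxrowK.
Qed.

Lemma in_cell d w n : (forall i, d i <= m)%N ->
  in_elem_interval #|F| d (cell d w) (net n) =
  ((digit_vec eta n)^T *m joint_mx C *m block_mask F m d == w *m block_mask F m d).
Proof.
move=> dm; apply/forallP/eqP => [in_n|/mxrowP E i].
  apply/mxrowP => i; rewrite !submxrow_mul_block_mask; apply/eqP.
  rewrite -(eq_coord_prefix i _ _ (dm i)); have := in_n i.
  by rewrite digital_netE (mem_elem_side q_gt0) // => j; exact: coord_digits_lt.
rewrite digital_netE mem_elem_side // => [|j]; last exact: coord_digits_lt.
by rewrite (eq_coord_prefix i _ _ (dm i)) -!submxrow_mul_block_mask E.
Qed.

(** [digit_vec_bij] replaces the index [n] by a vector [y] running once through the whole space. *)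
Lemma card_cell d w : (forall i, d i <= m)%N ->
  #|[set n | in_elem_interval #|F| d (cell d w) (net n)]| =
  #|[set y : 'rV[F]_m | y *m joint_mx C *m block_mask F m d == w *m block_mask F m d]|.
Proof.
move=> dm; rewrite -(on_card_preimset (onW_bij _ digit_vec_bij)).
by apply: eq_card => n; rewrite !inE in_cell.
Qed.

Lemma generates_digital_netP u e : (u <= m)%N ->
  generates_digital_net R eta kappa C u e <-> admissible_rows_free C u e.
Proof.
move=> um; have d_le (d : 'I_s -> nat) : (\sum_i d i <= m - u)%N -> (forall i, d i <= m)%N.
  by move=> sd i; move: sd; rewrite (bigD1 i) //=; lia.
have equi d : (forall i, d i <= m)%N -> _ := fun dm =>
  mulmx_equidistributedP (joint_mx C) (tr_block_mask F m d) (block_mask_idem F dm).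
split=> [[_ is_n] d ed sd|free].
  have dm := d_le d sd; apply: (equi d dm).1 => w.
  rewrite -card_cell // rank_block_mask //.
  have sdm : (\sum_i d i <= m)%N by rewrite (leq_trans sd) ?leq_subr.
  apply/(count_elem_volume R q_gt1 _ (cell d w) sdm).
  by apply: is_n => // [i|]; [exact: cell_lt | rewrite le_elem_volume].
split=> [n i|d a aq ed]; first exact: digital_net_range.
rewrite le_elem_volume // => sd; have dm := d_le d sd.
have sdm : (\sum_i d i <= m)%N by rewrite (leq_trans sd) ?leq_subr.
(* The given interval is a cell, so its points form a fibre of known size. *)
have [w /funext wa] := cell_surj dm aq; rewrite -wa.
apply/(count_elem_volume R q_gt1 _ _ sdm).
by rewrite card_cell // (equi d dm).2 ?rank_block_mask //; exact: free.
Qed.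

End DigitalNetPoints.

Theorem theorem7 (R : realType) (F : finFieldType) (s m u : nat)
    (s_ge1 : (1 <= s)%N) (m_ge1 : (1 <= m)%N) (u_le_m : (u <= m)%N)
    (e : 'I_s -> nat) (e_gt0 : forall i, (0 < e i)%N)
    (eta : 'I_m -> 'I_#|F| -> F) (kappa : 'I_s -> 'I_m -> F -> 'I_#|F|)
    (eta_bij : forall r, bijective (eta r))
    (kappa_bij : forall i j, bijective (kappa i j))
    (C : 'I_s -> 'M[F]_m) :
  let delta_dual := delta e (dual_space (row_space (joint_mx C))) in
  let net := generates_digital_net R eta kappa C u e in
  ((forall i, C i \in unitmx) -> (net <-> (m - u + 1 <= delta_dual)%N)) /\
  (((m - u + 1 <= delta_dual)%N -> net) /\
   (net -> (m - u <= delta_dual)%N)).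
Proof.
move=> delta_dual net.
have netP : net <-> admissible_rows_free C u e by exact: generates_digital_netP.
have net_of_delta : (m - u + 1 <= delta_dual)%N -> net.
  by move=> le_delta; apply/netP; exact: delta_admissible_rows_free.
split=> [C_unit|]; split=> // /netP free.
- exact: admissible_rows_free_unit_delta.
- exact: admissible_rows_free_delta.
Qed.
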